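(* Let $G$ be a finite triangle-free graph of maximum degree $\Delta$. Then \[ \chi_f(G) \le 1 + \min_{k\in \mathbb{N}} \inf_{\lambda>0} \frac{(1+\lambda)^k+\lambda(1+\lambda)\Delta}{\lambda(1+k\lambda)}, \] where $\mathbb{N}$ denotes the positive integers.
   Context: The fractional chromatic number $\chi_f(G)$ of a graph $G$ is the minimum of $\sum_{I} w_I$ over all assignments of weights $w_I\in[0,1]$ to the maximal independent sets $I$ of $G$ such that for every vertex $v$, $\sum_{I\ni v} w_I \ge 1$. *)

(* Defs.v *)
From HB Require Import structures.
From mathcomp Require Import all_boot all_order all_algebra.
From mathcomp Require Import all_classical all_reals all_analysis.
From mathcomp Require Import lra.

Set Implicit Arguments.
Unset Strict Implicit.
Unset Printing Implicit Defensive.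

Import Order.TTheory GRing.Theory Num.Theory.
Import numFieldNormedType.Exports.

Local Open Scope classical_set_scope.
Local Open Scope ring_scope.

(* A finite simple graph is a symmetric irreflexive relation on a finType;
   symmetry and irreflexivity are left to the statements that need them. *)

Definition triangle_free (T : finType) (e : rel T) : Prop :=
  forall x y z : T, e x y -> e y z -> ~~ e x z.

Definition max_degree (T : finType) (e : rel T) : nat :=
  \max_(v : T) #|[pred u | e v u]|.

Definition independent (T : finType) (e : rel T) (I : {set T}) : bool :=
  [forall u in I, forall v in I, ~~ e u v].

Definition max_independent (T : finType) (e : rel T) (I : {set T}) : bool :=
  maxset (independent e) I.

(* Only the values of w on maximal independent sets matter. *)
Definition fractional_colouring (R : realType) (T : finType) (e : rel T)
    (w : {set T} -> R) : Prop :=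
  (forall I, max_independent e I -> 0 <= w I <= 1) /\
  (forall v : T, 1 <= \sum_(I : {set T} | max_independent e I && (v \in I)) w I).

Definition total_weight (R : realType) (T : finType) (e : rel T)
    (w : {set T} -> R) : R :=
  \sum_(I : {set T} | max_independent e I) w I.

(* This infimum is a minimum: see [fractional_chromatic_number_min]. *)
Definition fractional_chromatic_number (R : realType) (T : finType)
    (e : rel T) : R :=
  inf [set total_weight e w | w in fractional_colouring (R := R) e].

Arguments fractional_chromatic_number R {T} e.

Definition bound (R : realType) (Delta k : nat) (l : R) : R :=
  ((1 + l) ^+ k + l * (1 + l) * Delta%:R) / (l * (1 + k%:R * l)).

Definition inf_bound (R : realType) (Delta k : nat) : R :=
  inf [set bound Delta k l | l in [set l : R | 0 < l]].

Arguments inf_bound R Delta k : clear implicits.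

(* This infimum is a minimum: see [min_inf_bound_attained]. *)
Definition min_inf_bound (R : realType) (Delta : nat) : R :=
  inf [set inf_bound R Delta k | k in [set k : nat | (0 < k)%N]].

Arguments min_inf_bound R Delta : clear implicits.

Section FractionalChromaticNumber.
Variables (R : realType) (T : finType) (e : rel T).
Hypothesis e_irr : irreflexive e.

Let trunc (w : {set T} -> R) (I : {set T}) : R :=
  if max_independent e I then w I else 0.

Let trunc_feasible w :
  fractional_colouring e w -> fractional_colouring e (trunc w).
Proof.
move=> [w01 w1]; split=> [I mI|v]; first by rewrite /trunc mI w01.
apply: le_trans (w1 v) _; apply: ler_sum => I /andP[mI _].
by rewrite /trunc mI.
Qed.

Let trunc_total w : total_weight e (trunc w) = total_weight e w.
Proof. by apply: eq_bigr => I mI; rewrite /trunc mI. Qed.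

Lemma fractional_colouring1 : fractional_colouring e (fun=> 1 : R).
Proof.
split=> [I _|v]; first by rewrite ler01 lexx.
have iv : independent e [set v].
  by apply/forall_inP => x /set1P->; apply/forall_inP => y /set1P->; rewrite e_irr.
have [I mI vI] := maxset_exists iv.
rewrite (bigD1 I) /=; last by rewrite /max_independent mI -finset.sub1set.
by rewrite lerDl sumr_ge0.
Qed.

Lemma fractional_chromatic_number_min :
  exists2 w : {set T} -> R, fractional_colouring e w &
    total_weight e w = fractional_chromatic_number R e /\
    forall w', fractional_colouring e w' -> total_weight e w <= total_weight e w'.
Proof.
pose X := prod_topology (fun _ : {set T} => R : topologicalType).
pose B := [set f : X | forall i, `[0, 1]%classic (f i)].
have cB : compact B.
  apply: (@tychonoff _ (fun=> R : topologicalType) (fun=> `[0, 1]%classic)) => I.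
  exact: segment_compact.
have cont (P : pred {set T}) :
    continuous (fun f : X => \sum_(I : {set T} | P I) f I : R).
  apply: continuous_big; first exact: add_continuous.
  by move=> I _; exact: (@proj_continuous _ (fun=> R : topologicalType)).
pose C v := [set f : X |
  1 <= \sum_(I : {set T} | max_independent e I && (v \in I)) f I :> R].
have clC v : closed (C v).
  have -> : C v = (fun f : X => \sum_(I : {set T} | max_independent e I && (v \in I))
      f I : R) @^-1` [set x | 1 <= x] by [].
  by apply: preimage_closed; [move=> f _; exact: cont | exact: closed_ge].
pose F := B `&` \bigcap_v C v.
have cF : compact F.
  by apply: compact_closedI => //; apply: closed_bigI => v _; exact: clC.
have truncF w : fractional_colouring e w -> F (trunc w).
  move=> fw; have [w01 w1] := trunc_feasible fw; split=> [I|v _]; last exact: w1.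
  rewrite /= in_itv /= /trunc; case: ifP => [mI|_]; last by rewrite lexx ler01.
  by case: fw => + _; exact.
have F0 : F !=set0 by exists (trunc (fun=> 1)); apply/truncF/fractional_colouring1.
have [w] : exists2 w : X, w \in F &
    forall t, t \in F -> total_weight e w <= total_weight e t.
  by apply: compact_EVT_min => //; apply: continuous_subspaceT; exact: cont.
rewrite inE => -[w01 w1] minw.
have fw : fractional_colouring e w.
  split=> [I _|v]; last exact: w1.
  by have := w01 I; rewrite /= in_itv.
have minw' w' : fractional_colouring e w' -> total_weight e w <= total_weight e w'.
  by move=> /truncF Fw'; rewrite -(trunc_total w'); apply: minw; rewrite inE.
exists w => //; split=> //; apply/eqP; rewrite eq_le; apply/andP; split.
  by apply: lb_le_inf; [exists (total_weight e w), w | move=> _ [w' fw' <-]; exact: minw'].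
apply: ge_inf; last by exists w.
by exists (total_weight e w) => _ [w' fw' <-]; exact: minw'.
Qed.

End FractionalChromaticNumber.

Section InfBound.
Variables (R : realType) (Delta : nat).

Lemma bound_ge0 (k : nat) (l : R) : 0 < l -> 0 <= bound Delta k l.
Proof.
move=> l0; apply: divr_ge0; last by rewrite mulr_ge0 ?addr_ge0 ?mulr_ge0 // ltW.
by rewrite addr_ge0 ?exprn_ge0 ?mulr_ge0 ?addr_ge0 // ltW.
Qed.

Lemma inf_bound_le (k : nat) (l : R) : 0 < l -> inf_bound R Delta k <= bound Delta k l.
Proof.
move=> l0; apply: ge_inf; last by exists l.
by exists 0 => _ [m m0 <-]; exact: bound_ge0.
Qed.

Lemma exprn_quad (k : nat) (l : R) : 0 < l ->
  1 + k%:R * l + k%:R * (k%:R - 1) / 2 * l ^+ 2 <= (1 + l) ^+ k.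
Proof.
move=> l0; elim: k => [|k IHk]; first by rewrite expr0; lra.
have l1 : 0 < 1 + l by lra.
rewrite [leRHS]exprS; rewrite -(ler_pM2l l1) in IHk; apply: (le_trans _ IHk).
have k3 : 0 <= k%:R * (k%:R - 1) / 2 * l ^+ 3 :> R.
  rewrite mulr_ge0 ?exprn_ge0 ?divr_ge0 ?(ltW l0) //.
  by case: (k) => [|n]; rewrite ?mul0r // -natr1 addrK mulr_ge0.
rewrite -natr1; move: k3; rewrite !exprS expr0; lra.
Qed.

Lemma inf_bound_ge (k : nat) : (1 < k)%N -> k%:R / 4 <= inf_bound R Delta k.
Proof.
move=> k1; apply: lb_le_inf; first by exists (bound Delta k 1), 1; rewrite /= ?ltr01.
move=> _ [l /= l0 <-].
have k2 : 2 <= k%:R :> R by rewrite (ler_nat R 2).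
have kl : 0 < k%:R * l by rewrite mulr_gt0 //; lra.
rewrite ler_pdivlMr; last by rewrite mulr_gt0 //; lra.
have num_ge : (1 + l) ^+ k <= (1 + l) ^+ k + l * (1 + l) * Delta%:R.
  by rewrite lerDl !mulr_ge0 //; lra.
apply: (le_trans _ num_ge); apply: (le_trans _ (exprn_quad k l0)).
set x := k%:R * l in kl *.
have -> : k%:R / 4 * (l * (1 + x)) = x * (1 + x) / 4 by rewrite /x; lra.
have : 0 <= (k%:R - 2) * k%:R * l ^+ 2 :> R.
  by rewrite !mulr_ge0 ?exprn_ge0 //; lra.
rewrite /x in kl *; rewrite !exprS expr0; lra.
Qed.

Lemma min_inf_bound_attained :
  exists2 k, (0 < k)%N & min_inf_bound R Delta = inf_bound R Delta k /\
    forall j, (0 < j)%N -> inf_bound R Delta k <= inf_bound R Delta j.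
Proof.
pose N := (Num.truncn (4 * `|inf_bound R Delta 1|)).+2.
pose f (i : 'I_N) := inf_bound R Delta i.+1.
pose k := [arg min_(i < (ord0 : 'I_N)) f i]%O.
have mink : forall i, f k <= f i.
  by rewrite /k; case: arg_minP => // i _ mi j; exact: mi.
have minj j : (0 < j)%N -> inf_bound R Delta k.+1 <= inf_bound R Delta j.
  case: j => // j _; have [jN|Nj] := ltnP j N; first exact: (mink (Ordinal jN)).
  apply: le_trans (mink ord0) _; apply: le_trans (ler_norm _) _.
  apply: le_trans (inf_bound_ge _); last by rewrite ltnS (leq_trans _ Nj).
  rewrite ler_pdivlMr // mulrC.
  apply: le_trans (ltW (truncnS_gt _)) _.
  by rewrite ler_nat; apply: leq_trans (leqnSn _) _; exact: leqW.
exists k.+1 => //; split=> //; apply/eqP; rewrite eq_le; apply/andP; split.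
  apply: ge_inf; last by exists k.+1.
  by exists (inf_bound R Delta k.+1) => _ [j j0 <-]; exact: minj.
by apply: lb_le_inf; [exists (inf_bound R Delta 1), 1%N | move=> _ [j j0 <-]; exact: minj].
Qed.

End InfBound.

(* Main.v *)
(* For the hard-core measure at fugacity l, condition on the random independent
   set S outside the closed neighbourhood of v: by triangle-freeness the w
   unblocked neighbours of v are independent, so v and these neighbours induce a
   star. Explicit weights a, b make a P(v in S) + b E|N(v) & S| >= 1 for every w,
   hence on every induced subgraph. A greedy procedure then uses, at each stage,
   the measure on the subgraph of not yet covered vertices until a new vertex is
   fully covered; the inequality, integrated up to the time at which the last
   vertex gets covered, bounds the total time by a + b * Delta. *)

Require Import Defs.
From mathcomp Require Import all_boot all_order all_algebra.
From mathcomp Require Import all_classical all_reals all_analysis.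
From mathcomp Require Import fintype finset ring lra.

Set Implicit Arguments.
Unset Strict Implicit.
Unset Printing Implicit Defensive.

Import Order.TTheory GRing.Theory Num.Theory.

Local Open Scope ring_scope.

(** * Power inequalities and binomial sums over subsets *)

Section SubsetSums.
Variable R : realType.

(** The left side equals 1 at m = 0 and does not increase with m, since (1 - (m+1) l) (1 + l) <= 1 -
    m l when l >= 0. *)
Lemma mul_expr1D_le1 (l : R) (m : nat) :
  0 <= l -> (1 - m%:R * l) * (1 + l) ^+ m <= 1.
Proof.
move=> l0; elim: m => [|m IHm]; first by rewrite mul0r subr0 mulr1.
apply: le_trans IHm; rewrite exprS mulrA ler_wpM2r ?exprn_ge0 ?addr_ge0 //.
rewrite -natr1; have : 0 <= (m%:R + 1) * l ^+ 2 by rewrite mulr_ge0 ?addr_ge0 ?sqr_ge0.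
by lra.
Qed.

(** Divided by (1 + l)^w this is Bernoulli's inequality for the integer exponent k - w, of either
    sign; equality holds at w = k. For w > k it comes from [mul_expr1D_le1]. *)
Lemma expr1D_tangent (l : R) (k w : nat) : 0 <= l ->
  (1 + l) ^+ w * (1 + k%:R * l - w%:R * l) <= (1 + l) ^+ k.
Proof.
move=> l0; have l1 : 0 <= 1 + l by rewrite addr_ge0.
have [wk|/ltnW kw] := leqP w k.
  rewrite -{2}(subnKC wk) exprD ler_wpM2l ?exprn_ge0 // -addrA -mulrBl -natrB //.
  elim: (k - w)%N => [|m IHm]; first by rewrite mul0r addr0.
  rewrite exprS -natr1; apply: le_trans (ler_wpM2l l1 IHm).
  have : 0 <= m%:R * l ^+ 2 by rewrite mulr_ge0 ?sqr_ge0.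
  by lra.
rewrite -{1}(subnKC kw) exprD -mulrA ler_piMr ?exprn_ge0 // mulrC.
apply: le_trans (mul_expr1D_le1 (w - k) l0).
by rewrite ler_wpM2r ?exprn_ge0 ?natrB //; lra.
Qed.

Variable T : finType.

Lemma sum_subsets_card (W : {set T}) (F : nat -> R) :
  \sum_(X : {set T} | X \subset W) F #|X| =
  \sum_(i < #|W|.+1) F i *+ 'C(#|W|, i).
Proof.
rewrite (partition_big (fun X : {set T} => inord #|X| : 'I_(#|W|.+1)) xpredT) //=.
apply: eq_bigr => i _; rewrite -cards_draws -sumr_const.
have cX (X : {set T}) : X \subset W -> (#|X| < #|W|.+1)%N.
  by move=> XW; rewrite ltnS subset_leq_card.
apply: eq_big => [X|X /andP[XW /eqP <-]]; last by rewrite inordK ?cX.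
by rewrite inE; case: (boolP (X \subset W)) => //= XW; rewrite -val_eqE /= inordK ?cX.
Qed.

Lemma sum_subsets_expr (W : {set T}) (l : R) :
  \sum_(X : {set T} | X \subset W) l ^+ #|X| = (1 + l) ^+ #|W|.
Proof.
rewrite (sum_subsets_card W (fun i => l ^+ i)) exprDn.
by apply: eq_bigr => i _; rewrite expr1n mul1r.
Qed.

(** The binomial theorem differentiated in l and multiplied by l; the factor 1 + l on the left
    avoids the exponent #|W| - 1. *)
Lemma sum_subsets_card_expr (W : {set T}) (l : R) :
  (1 + l) * \sum_(X : {set T} | X \subset W) #|X|%:R * l ^+ #|X| =
  #|W|%:R * l * (1 + l) ^+ #|W|.
Proof.
rewrite (sum_subsets_card W (fun i => i%:R * l ^+ i)).
case: #|W| => [|w]; first by rewrite big_ord1 !mul0r mul0rn mulr0.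
rewrite big_ord_recl !mul0r mul0rn add0r /= exprS mulrCA; congr (_ * _).
rewrite exprDn mulr_sumr; apply: eq_bigr => i _.
have := congr1 (fun n => n%:R : R) (mul_bin_diag w.+1 i).
rewrite !natrM => E; rewrite expr1n mul1r /bump /= add1n exprS -[LHS]mulr_natr.
rewrite -[l ^+ i *+ _]mulr_natr.
transitivity ((i.+1%:R * 'C(w.+1, i.+1)%:R) * (l * l ^+ i)); first by ring.
by rewrite -E /=; ring.
Qed.

End SubsetSums.

(** * The hard-core measure and its local inequality *)

Section HardCore.
Variables (R : realType) (T : finType) (e : rel T).

Lemma independentP (I : {set T}) :
  reflect {in I &, forall x y, ~~ e x y} (independent e I).
Proof.
apply: (iffP forall_inP) => [h x y xI yI|h x xI]; first exact: (forall_inP (h x xI)).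
by apply/forall_inP => y yI; exact: h.
Qed.

(** All independent sets count here, not only the maximal ones, because hard-core samples need not
    be maximal. For a probability distribution c this is the probability that v is occupied. *)
Definition coverage (c : {set T} -> R) (v : T) : R :=
  \sum_(I : {set T} | independent e I && (v \in I)) c I.

Lemma coverage_ge0 c v : (forall I, 0 <= c I) -> 0 <= coverage c v.
Proof. by move=> c0; apply: sumr_ge0. Qed.

Lemma coverageDZ (c p : {set T} -> R) (s : R) v :
  coverage (fun I => c I + s * p I) v = coverage c v + s * coverage p v.
Proof. by rewrite /coverage big_split mulr_sumr. Qed.

Lemma sum_coverage_neighbours c v :
  \sum_(u | e v u) coverage c u =
  \sum_(I : {set T} | independent e I) #|[set u | e v u] :&: I|%:R * c I.
Proof.
rewrite /coverage (exchange_big_dep (independent e)) /=; last by move=> u I _ /andP[].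
apply: eq_bigr => I iI; rewrite -sum1_card natr_sum mulr_suml.
by apply: eq_big => [u|u _]; rewrite ?inE ?iI ?mul1r.
Qed.


(* The weights a and b of the header; b is chosen so that the number w of
   unblocked neighbours most demanding on a is w = k. *)
Definition occupancy_weight (k : nat) (l : R) : R :=
  1 + (1 + l) ^+ k / (l * (1 + k%:R * l)).

Definition neighbour_weight (k : nat) (l : R) : R :=
  (1 + l) / (1 + k%:R * l).

(* The term outside the sum is the contribution of the independent set {v} of the
   star with centre v and leaves W. *)
Lemma hard_core_star_ge0 (W : {set T}) (k : nat) (l : R) : 0 < l ->
  0 <= l * (occupancy_weight k l - 1) +
    \sum_(X : {set T} | X \subset W) l ^+ #|X| * (neighbour_weight k l * #|X|%:R - 1).
Proof.
move=> l0; have kl0 : 0 < 1 + k%:R * l by rewrite ltr_pwDl ?mulr_ge0 // ltW.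
under eq_bigr => X _ do rewrite mulrBr mulr1 mulrCA [l ^+ _ * _]mulrC.
rewrite sumrB -mulr_sumr sum_subsets_expr /neighbour_weight mulrAC.
rewrite sum_subsets_card_expr /occupancy_weight.
(* For this choice of weights the whole expression is the gap in [expr1D_tangent], with w = #|W|,
   divided by 1 + k l. *)
have -> : l * (1 + (1 + l) ^+ k / (l * (1 + k%:R * l)) - 1) +
    (#|W|%:R * l * (1 + l) ^+ #|W| / (1 + k%:R * l) - (1 + l) ^+ #|W|) =
  ((1 + l) ^+ k - (1 + l) ^+ #|W| * (1 + k%:R * l - #|W|%:R * l)) / (1 + k%:R * l).
  by field; rewrite !gt_eqF.
by apply: divr_ge0; last exact: ltW; rewrite subr_ge0 expr1D_tangent ?ltW.
Qed.

Hypotheses (e_sym : symmetric e) (e_irr : irreflexive e).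
Hypothesis e_triangle_free : triangle_free e.

(** This is where triangle-freeness enters. *)
Lemma independent_neighbours v : independent e [set u | e v u].
Proof.
apply/independentP => x y; rewrite !inE => vx vy.
by apply: (e_triangle_free _ vy); rewrite e_sym.
Qed.

(** The inequality of the header on the subgraph induced by H, multiplied by the partition function.
    Sets I are grouped by their part J outside the closed neighbourhood of v; each group contributes
    l^#|J| times the star sum of [hard_core_star_ge0]. *)
Lemma hard_core_local (H : {set T}) (v : T) (k : nat) (l : R) :
  0 < l -> v \in H ->
  0 <= \sum_(I : {set T} | independent e I && (I \subset H)) l ^+ #|I| *
    (occupancy_weight k l * (v \in I)%:R +
     neighbour_weight k l * #|[set u | e v u] :&: I|%:R - 1).
Proof.
move=> l0 vH; set N := [set u | e v u].
have vN : v \notin N by rewrite inE e_irr.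
rewrite (partition_big (fun I => I :\: (v |: N)) (fun J : {set T} =>
  [&& independent e J, J \subset H & [disjoint J & v |: N]])) /=; last first.
  move=> I /andP[/independentP iI IH]; apply/and3P; split.
  - by apply/independentP => x y /setDP[xI _] /setDP[yI _]; exact: iI.
  - exact: subset_trans (subsetDl _ _) IH.
  - by rewrite disjoints_subset; apply/subsetP => x; rewrite !inE => /andP[].
apply: sumr_ge0 => J /and3P[/independentP iJ JH dJ].
have vJ : v \notin J.
  by apply: contraTN isT => vJ; have := disjointFr dJ vJ; rewrite !inE eqxx.
have NJ u : u \in N -> u \notin J.
  move=> uN; apply: contraTN isT => uJ.
  by have := disjointFr dJ uJ; rewrite in_setU1 uN orbT.
(* The neighbours of v in H that J leaves unblocked. *)
pose W := [set u in N :&: H | [forall x in J, ~~ e u x]].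
(* A set of the group that contains v contains no neighbour of v, hence is [v |: J]. *)
rewrite (bigID (fun I : {set T} => v \in I)) /= (big_pred1 (v |: J)); last first.
  move=> I; apply/idP/eqP => [/andP[/andP[/andP[/independentP iI _] /eqP defJ] vI]|->].
    apply/setP => x; rewrite -defJ !inE; have [->|_ /=] := eqVneq x v; first by [].
    by case: (boolP (x \in I)) => xI; rewrite ?andbF // (negbTE (iI _ _ vI xI)).
  rewrite setU11 andbT; apply/andP; split; last first.
    apply/eqP/setP => x; rewrite !inE; have [->|_ /=] := eqVneq x v.
      by rewrite (negbTE vJ).
    case: (boolP (x \in J)) => xJ; rewrite ?andbF // andbT.
    by apply: contraL xJ => vx; apply: NJ; rewrite inE.
  rewrite subUset sub1set vH JH !andbT.
  have vJ' x : x \in J -> ~~ e v x.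
    by move=> xJ; apply: contraL xJ => vx; apply: NJ; rewrite inE.
  apply/independentP => x y /setU1P[->|xJ] /setU1P[->|yJ]; rewrite ?e_irr ?vJ' //.
    by rewrite e_sym vJ'.
  exact: iJ.
(* The sets of the group that avoid v are the [J :|: X] with X any subset of W. *)
rewrite (reindex_onto (fun X => J :|: X) (fun I => I :&: N)) /=; last first.
  move=> I /andP[/andP[_ /eqP <-] vI]; apply/setP => x; rewrite !inE.
  have [->|_ /=] := eqVneq x v; first by rewrite (negbTE vI) andbF.
  by case: (e v x); rewrite ?andbT ?andbF ?orbF ?orFb.
rewrite (eq_bigl (fun X : {set T} => X \subset W)); last first.
  move=> X; apply/idP/idP.
    move=> /andP[/andP[/andP[/andP[/independentP iJX JXH] _] _] /eqP defX].
    apply/subsetP => x xX; have := xX; rewrite -defX !inE => /andP[_ ->] /=.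
    rewrite (subsetP JXH) ?inE ?xX ?orbT //=; apply/forall_inP => y yJ.
    by apply: iJX; rewrite inE ?xX ?yJ ?orbT.
  move=> /subsetP XW.
  have XN x : x \in X -> [/\ x \in N, x \in H & {in J, forall y, ~~ e x y}].
    by move=> /XW; rewrite !inE => /andP[/andP[-> ->] /forall_inP].
  rewrite -!andbA; apply/and5P; split.
  - apply/independentP => x y /setUP[xJ|xX] /setUP[yJ|yX].
    + exact: iJ.
    + by rewrite e_sym; have [_ _ ->] := XN y yX.
    + by have [_ _ ->] := XN x xX.
    + have [xN _ _] := XN x xX; have [yN _ _] := XN y yX.
      exact: (independentP _ (independent_neighbours v)).
  - by rewrite subUset JH; apply/subsetP => x /XN[].
  - apply/eqP/setP => x; rewrite !inE.
    have [->|_ /=] := eqVneq x v; first by rewrite (negbTE vJ).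
    case: (boolP (x \in X)) => [/XN[xN _ _]|_].
      by move: (xN) (NJ _ xN); rewrite inE => -> /negbTE ->.
    rewrite orbF; case: (boolP (e v x)) => //= vx.
    by rewrite (negbTE (NJ x _)) // inE.
  - by rewrite inE (negbTE vJ) /=; apply: contra vN => /XN[].
  - apply/eqP/setP => x; rewrite in_setI in_setU.
    case: (boolP (x \in X)) => [/XN[-> _ _]|_]; first by rewrite orbT.
    by rewrite orbF; apply/negP => /andP[xJ /NJ]; rewrite xJ.
have NvJ : #|N :&: (v |: J)| = 0%N.
  apply/eqP; rewrite cards_eq0; apply/eqP/setP => x; rewrite in_setI in_setU1 in_set0.
  by apply/negP => /andP[xN /predU1P[xv|]]; [move: vN; rewrite -xv xN | apply/negP/NJ].
rewrite setU11 NvJ cardsU1 vJ /= mulr0 addr0 mulr1.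
have -> : \sum_(X : {set T} | X \subset W) l ^+ #|J :|: X| *
    (occupancy_weight k l * (v \in J :|: X)%:R +
     neighbour_weight k l * #|N :&: (J :|: X)|%:R - 1) =
  l ^+ #|J| * \sum_(X : {set T} | X \subset W)
    l ^+ #|X| * (neighbour_weight k l * #|X|%:R - 1).
  rewrite mulr_sumr; apply: eq_bigr => X /subsetP XW.
  have XN x : x \in X -> x \in N by move=> /XW; rewrite !inE => /andP[/andP[]].
  have -> : N :&: (J :|: X) = X.
    apply/setP => x; rewrite in_setI in_setU.
    case: (boolP (x \in X)) => [/XN->|_]; first by rewrite orbT.
    by rewrite orbF; apply/negP => /andP[/NJ] /negP.
  have -> : (v \in J :|: X) = false.
    by rewrite inE (negbTE vJ) /=; apply: contraNF vN; exact: XN.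
  rewrite mulr0 add0r cardsU; have -> : J :&: X = set0.
    apply/setP => x; rewrite in_setI in_set0.
    by apply/negP => /andP[xJ /XN/NJ]; rewrite xJ.
  by rewrite cards0 subn0 exprD mulrA.
rewrite exprD expr1 [l * _]mulrC -mulrA -mulrDr mulr_ge0 ?exprn_ge0 ?(ltW l0) //.
exact: hard_core_star_ge0.
Qed.

(** The witness is the hard-core measure on the subgraph induced by H, extended by 0; the last
    clause is [hard_core_local] divided by the partition function Z. Neighbours outside H may stay
    in its sum, as their coverage is 0. *)
Lemma hard_core_distribution (H : {set T}) (k : nat) (l : R) : 0 < l ->
  exists p : {set T} -> R,
    [/\ forall I, 0 <= p I, \sum_(I : {set T} | independent e I) p I = 1,
        forall v, v \notin H -> coverage p v = 0 &
        forall v, v \in H -> 1 <= occupancy_weight k l * coverage p v +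
          neighbour_weight k l * \sum_(u | e v u) coverage p u].
Proof.
move=> l0; pose Z := \sum_(I : {set T} | independent e I && (I \subset H)) l ^+ #|I|.
have Z0 : 0 < Z.
  rewrite /Z (bigD1 set0) /=; last first.
    by rewrite sub0set andbT; apply/independentP => x y; rewrite inE.
  by rewrite cards0 ltr_pwDl // sumr_ge0 // => I _; rewrite exprn_ge0 // ltW.
pose p (I : {set T}) := if I \subset H then l ^+ #|I| / Z else 0.
have sum_p F : \sum_(I : {set T} | independent e I) F I * p I =
    (\sum_(I : {set T} | independent e I && (I \subset H)) l ^+ #|I| * F I) / Z.
  rewrite mulr_suml big_mkcondr /=; apply: eq_bigr => I _; rewrite /p.
  by case: ifP; rewrite ?mulr0 // mulrCA mulrA.
have coverE v : coverage p v = \sum_(I : {set T} | independent e I) (v \in I)%:R * p I.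
  rewrite /coverage big_mkcondr; apply: eq_bigr => I _.
  by case: ifP; rewrite ?mul1r ?mul0r.
exists p; split=> [I||v vH|v vH].
- by rewrite /p; case: ifP => // _; rewrite divr_ge0 ?exprn_ge0 ?ltW.
- under eq_bigr do rewrite -[p _]mul1r.
  by rewrite sum_p; under eq_bigr do rewrite mulr1; rewrite divff ?gt_eqF.
- rewrite /coverage big1 // => I /andP[_ vI]; rewrite /p; case: ifP => // /subsetP IH.
  by rewrite (IH v vI) in vH.
rewrite sum_coverage_neighbours coverE !sum_p !mulrA -mulrDl ler_pdivlMr // mul1r.
rewrite -subr_ge0 !mulr_sumr -big_split -sumrB /=.
apply: le_trans (hard_core_local k l0 vH) _; apply: ler_sum => I _; lra.
Qed.

End HardCore.

(** * The greedy covering procedure *)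

Section Greedy.
Variables (R : realType) (T : finType) (e : rel T) (a b : R).
Hypotheses (a0 : 0 <= a) (b0 : 0 <= b).
Hypothesis local_distribution : forall H : {set T}, H != set0 ->
  exists p : {set T} -> R,
    [/\ forall I, 0 <= p I, \sum_(I : {set T} | independent e I) p I = 1,
        forall v, v \notin H -> coverage e p v = 0 &
        forall v, v \in H ->
          1 <= a * coverage e p v + b * \sum_(u | e v u) coverage e p u].

Lemma sum_neighbours_le (x : T -> R) (v : T) :
  (forall u, x u <= 1) -> \sum_(u | e v u) x u <= (max_degree e)%:R.
Proof.
move=> x1; apply: (@le_trans _ _ #|[pred u | e v u]|%:R).
  by rewrite -sum1_card natr_sum; apply: ler_sum => u _.
by rewrite ler_nat (leq_bigmax v).
Qed.

Lemma greedy_colouring :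
  exists c : {set T} -> R,
    [/\ forall I, 0 <= c I, forall v, 1 <= coverage e c v &
        \sum_(I : {set T} | independent e I) c I <= a + b * (max_degree e)%:R].
Proof.
pose total (c : {set T} -> R) := \sum_(I : {set T} | independent e I) c I.
pose score c v := a * coverage e c v + b * \sum_(u | e v u) coverage e c u.
have score_le c v : (forall u, coverage e c u <= 1) ->
    score c v <= a + b * (max_degree e)%:R.
  move=> c1; rewrite lerD //; first by rewrite -[leRHS]mulr1 ler_wpM2l.
  by rewrite ler_wpM2l // sum_neighbours_le.
(* Induction on the number of vertices not yet covered. The score of each of them dominates the
   elapsed time [total c]. The bound on [total c] is carried along because no such vertex remains at
   the end to deduce it from. *)
suff main n c : (forall I, 0 <= c I) -> (forall v, coverage e c v <= 1) ->
    total c <= a + b * (max_degree e)%:R ->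
    (forall v, coverage e c v < 1 -> total c <= score c v) ->
    (#|[set v | (coverage e c v < 1)%R]| <= n)%N ->
    exists c', [/\ forall I, 0 <= c' I, forall v, 1 <= coverage e c' v &
                   total c' <= a + b * (max_degree e)%:R].
  have cov0 v : coverage e (fun=> 0 : R) v = 0 by rewrite /coverage big1.
  have tot0 : total (fun=> 0) = 0 by rewrite /total big1.
  apply: (main #|T| (fun=> 0)) => // [v||v _|].
  - by rewrite cov0 ler01.
  - by rewrite tot0 addr_ge0 ?mulr_ge0.
  - by rewrite tot0 /score cov0 mulr0 add0r big1 ?mulr0.
  - exact: max_card.
elim: n c => [|n IHn] c c0 c1 tot_le tot_score.
  rewrite leqn0 cards_eq0 => /eqP H0; exists c; split=> // v.
  by rewrite leNgt; apply/negP => cv; have := in_set0 v; rewrite -H0 inE cv.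
set H := [set v | _] => cardH.
have [H0|Hn0] := eqVneq H set0.
  by apply: IHn => //; rewrite -/H H0 cards0.
have [p [p0 p1 pH p_score]] := local_distribution Hn0.
(* Otherwise the local inequality at a vertex of H would read 1 <= 0. *)
have [v0 pv0] : exists v, 0 < coverage e p v.
  have /set0Pn[v vH] := Hn0; apply/existsP; apply/existsP; apply: contrapT => np.
  have pv u : coverage e p u = 0.
    apply/eqP; rewrite eq_le coverage_ge0 // andbT leNgt.
    by apply/negP => pu; apply: np; exists u.
  by have := p_score v vH; rewrite pv mulr0 add0r big1 // mulr0 ler10.
(* The further time v needs to be fully covered at rate [coverage e p v]; stopping at the least such
   time keeps all coverages at most 1. *)
pose f v := (1 - coverage e c v) / coverage e p v.
pose v1 := [arg min_(v < v0 | 0 < coverage e p v) f v]%O.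
have [pv1 min_v1] : 0 < coverage e p v1 /\
    forall v, 0 < coverage e p v -> f v1 <= f v.
  by rewrite /v1; case: arg_minP.
have v1H : v1 \in H by apply: contraTT pv1 => /pH->; rewrite ltxx.
pose s := f v1.
have s0 : 0 <= s by rewrite divr_ge0 ?subr_ge0 // ltW.
(* s is the time at which a new vertex, v1, gets fully covered. *)
pose c' I := c I + s * p I.
have cov' v : coverage e c' v = coverage e c v + s * coverage e p v.
  exact: coverageDZ.
have tot' : total c' = total c + s.
  by rewrite /total big_split -mulr_sumr p1 mulr1.
have score' v : score c' v = score c v + s * score p v.
  rewrite /score cov'; under eq_bigr do rewrite cov'.
  by rewrite big_split -mulr_sumr /=; ring.
have cov'_le1 v : coverage e c' v <= 1.
  rewrite cov'; have := coverage_ge0 e v p0; rewrite le_eqVlt => /predU1P[<-|pv].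
    by rewrite mulr0 addr0.
  by rewrite addrC -lerBrDr -ler_pdivlMr // min_v1.
have cov_le v : coverage e c v <= coverage e c' v.
  by rewrite cov' lerDl mulr_ge0 ?coverage_ge0.
(* On H the score grows at rate at least 1, the rate at which the total grows. *)
have step v : v \in H -> total c' <= score c' v.
  move=> vH; rewrite tot' score' lerD ?tot_score //; first by move: vH; rewrite inE.
  by rewrite -[leLHS]mulr1 ler_wpM2l // p_score.
apply: (IHn c') => //.
- by move=> I; exact: addr_ge0 (c0 I) (mulr_ge0 s0 (p0 I)).
(* Although v1 is now covered, it was in H during this stage, so its score still bounds the new
   total. *)
- exact: le_trans (step _ v1H) (score_le _ _ cov'_le1).
- by move=> v cv; apply: step; rewrite inE (le_lt_trans (cov_le v)).
rewrite -ltnS; apply: leq_trans cardH; apply/proper_card/properP; split.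
  by apply/subsetP => v; rewrite !inE; exact: le_lt_trans.
by exists v1 => //; rewrite inE cov' /s /f divfK ?gt_eqF // addrC subrK ltxx.
Qed.

End Greedy.

(** * From independent sets to maximal independent sets *)

Section Saturation.
Variables (R : realType) (T : finType) (e : rel T).

(** The weight of each independent set J moves to a maximal independent set [ext J] containing it:
    the total is unchanged and no vertex loses coverage. *)
Lemma fractional_chromatic_number_le (c : {set T} -> R) :
  irreflexive e -> (forall I, 0 <= c I) -> (forall v, 1 <= coverage e c v) ->
  fractional_chromatic_number R e <= \sum_(I : {set T} | independent e I) c I.
Proof.
move=> e_irr c0 c1.
have /choice[ext extP] (J : {set T}) : exists I : {set T},
    independent e J -> max_independent e I /\ J \subset I.
  have [/maxset_exists[I mI JI]|] := boolP (independent e J); first by exists I.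
  by exists J.
pose g I := \sum_(J : {set T} | independent e J && (ext J == I)) c J.
have g0 I : 0 <= g I by apply: sumr_ge0.
(* A maximal independent set may receive more than 1, whence the cap, which
   keeps each of its vertices covered. *)
pose w I := Num.min 1 (g I).
have fw : fractional_colouring e w.
  split=> [I _|v]; first by rewrite /w le_min ler01 g0 ge_min lexx.
  have w0 I : 0 <= w I by rewrite le_min ler01 g0.
  have [/existsP[I /andP[/andP[mI vI] gI]]|] :=
    boolP [exists I : {set T}, max_independent e I && (v \in I) && (1 <= g I)].
    rewrite (bigD1 I) ?mI ?vI //= /w min_l // lerDl sumr_ge0 // => J _; exact: w0.
  (* Here the cap is inactive on every maximal independent set containing v, so w agrees with g
     there. *)
  rewrite negb_exists => /forallP small.
  rewrite (eq_bigr g) => [|I /andP[mI vI]]; last first.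
    by apply: min_r; apply: ltW; move: (small I); rewrite mI vI -ltNge.
  apply: le_trans (c1 v) _; rewrite /coverage /g.
  rewrite (partition_big ext (fun I => max_independent e I && (v \in I))) /=; last first.
    by move=> J /andP[/extP[mJ /subsetP JI] vJ]; rewrite mJ JI.
  apply: ler_sum => I _; rewrite [leRHS]big_mkcond [leLHS]big_mkcond /=.
  by apply: ler_sum => J _;
    case: (independent e J); case: (v \in J); case: (ext J == I); rewrite /= ?lexx ?c0.
have [w' _ [<- min_w']] := fractional_chromatic_number_min R e_irr.
apply: le_trans (min_w' _ fw) _; rewrite /total_weight.
rewrite [leRHS](partition_big ext (max_independent e)) /=; last by move=> J /extP[].
by apply: ler_sum => I _; rewrite ge_min lexx orbT.
Qed.

End Saturation.

(** * The bound for an optimal k and arbitrary l *)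

Theorem theorem1p9 (R : realType) (T : finType) (e : rel T) (Delta : nat)
    (e_sym : symmetric e) (e_irr : irreflexive e)
    (e_triangle_free : triangle_free e) (e_Delta : max_degree e = Delta) :
  fractional_chromatic_number R e <= 1 + min_inf_bound R Delta.
Proof.
have [k _ [-> _]] := min_inf_bound_attained R Delta.
rewrite -lerBlDl; apply: lb_le_inf; first by exists (bound Delta k 1), 1; rewrite /= ?ltr01.
move=> _ [l /= l0 <-]; rewrite lerBlDl.
have kl0 : 0 < 1 + k%:R * l by rewrite ltr_pwDl ?mulr_ge0 // ltW.
have [] := @greedy_colouring R T e (occupancy_weight k l) (neighbour_weight k l).
- by rewrite addr_ge0 // divr_ge0 ?exprn_ge0 ?addr_ge0 ?(ltW l0) // mulr_ge0 ?ltW.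
- by rewrite divr_ge0 ?(ltW kl0) // addr_ge0 ?(ltW l0).
- by move=> H _; exact: hard_core_distribution.
move=> c [c0 c1 cle]; apply: le_trans (fractional_chromatic_number_le e_irr c0 c1) _.
apply: le_trans cle _; rewrite e_Delta /occupancy_weight /neighbour_weight /bound.
(* Both sides are equal: a + b * Delta is exactly 1 + [bound Delta k l]. *)
rewrite le_eqVlt; apply/orP; left; apply/eqP; field.
by rewrite !gt_eqF.
Qed.
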